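(* Let $r\ge2$ and $1\le s\le r/2$, and let $H$ be an $r$-uniform hypergraph on a finite vertex set $V$, $|V|=n\ge r$, such that every $s$-subset of $V$ is contained in at least one edge. Let $\lambda_1^{(s)}$ and $\lambda_{\max}^{(s)}$ be the first non-trivial (second smallest) and the largest eigenvalue of the $s$-th Laplacian of $H$. If $\lambda_{\max}^{(s)}>\lambda_1^{(s)}>0$, then the $s$-diameter of $H$ satisfies $$\mathrm{diam}^{(s)}(H)\le\left\lceil\frac{\log\frac{\mathrm{vol}(V^{\underline{s}})}{\delta^{(s)}}}{\log\frac{\lambda_{\max}^{(s)}+\lambda_1^{(s)}}{\lambda_{\max}^{(s)}-\lambda_1^{(s)}}}\right\rceil,$$ where $\mathrm{vol}(V^{\underline{s}})=\sum_{x\in V^{\underline{s}}}d_x=|E(H)|\frac{r!}{(r-2s)!}$ and $\delta^{(s)}=\min_{x}d_x$ is the minimum degree in $G^{(s)}$.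
   Context: $V^{\underline{s}}$ is the set of ordered $s$-tuples of distinct elements of $V$; for $x\in V^{\underline{s}}$, $[x]$ is the $s$-set of its coordinates. An $r$-uniform hypergraph $H$ has edge set $E(H)\subseteq\binom{V}{r}$. For $S\subseteq V$ with $|S|<r$, $d_S$ is the number of edges containing $S$. An $s$-walk of length $k\ge 0$ is a sequence of vertices $v_1,\dots,v_{(r-s)(k-1)+r}$ such that $F_i=\{v_{(r-s)(i-1)+1},\dots,v_{(r-s)(i-1)+r}\}$ is an edge of $H$ (with $r$ distinct vertices) for $1\le i\le k$. Its $i$-th stop ($0\le i\le k$) is $x_i=(v_{(r-s)i+1},\dots,v_{(r-s)i+s})\in V^{\underline{s}}$; it starts at $x_0$ and ends at $x_k$. It is an $s$-path if all its stops are distinct. The $s$-distance $d^{(s)}(x,y)$ is the minimum length of an $s$-path from $x$ to $y$, and $\mathrm{diam}^{(s)}(H)=\max_{x,y\in V^{\underline{s}}}d^{(s)}(x,y)$. For $1\le s\le r/2$, $G^{(s)}$ is the weighted undirected graph on $V^{\underline{s}}$ with $w(x,y)=|\{F\in E(H):[x]\cup[y]\subseteq F\}|$ if $[x]\cap[y]=\emptyset$ and $w(x,y)=0$ otherwise. The degree of $x$ is $d_x=\sum_y w(x,y)=d_{[x]}\binom{r-s}{s}s!$; the $s$-distance in $H$ equals the graph distance in $G^{(s)}$ (where $x,y$ are adjacent iff $w(x,y)>0$). Let $A=(w(x,y))$ and $T=\mathrm{diag}(d_x)$; the $s$-th Laplacian is $\mathcal L^{(s)}=I-T^{-1/2}AT^{-1/2}$,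 with eigenvalues listed in non-decreasing order with multiplicity as $\lambda_0^{(s)}\le\lambda_1^{(s)}\le\cdots\le\lambda_{\max}^{(s)}$. *)

(* Defs.v *)
From HB Require Import structures.
From mathcomp Require Import all_boot all_order all_algebra.
From mathcomp Require Import polyrcf.
From mathcomp Require Import all_classical all_reals all_analysis.

Set Implicit Arguments.
Unset Strict Implicit.
Unset Printing Implicit Defensive.

Import Order.TTheory GRing.Theory Num.Theory.

Local Open Scope ring_scope.

Section Spectrum.
Variable R : rcfType.

(* The real eigenvalues of [M] in non-decreasing order, each repeated according
   to its multiplicity as a root of the characteristic polynomial ([rootsR] is
   the increasing list of the distinct roots). For a symmetric [M] these are
   all [N] eigenvalues. *)
Definition spectrum (N : nat) (M : 'M[R]_N) : seq R :=
  flatten [seq nseq (mup a (char_poly M)) a | a <- rootsR (char_poly M)].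

Definition eigval (N : nat) (M : 'M[R]_N) (i : nat) : R := (spectrum M)`_i.

Definition eigval_max (N : nat) (M : 'M[R]_N) : R := last 0 (spectrum M).

End Spectrum.

Definition distinct_tuple (V : finType) (s : nat) : Type :=
  {t : s.-tuple V | uniq t}.
HB.instance Definition _ (V : finType) (s : nat) :=
  Finite.on (distinct_tuple V s).

Section Hypergraph.
Variable V : finType.

Definition uniform (r : nat) (E : {set {set V}}) : Prop :=
  forall F, F \in E -> #|F| = r.

Section AuxiliaryGraph.
Variables (s : nat) (E : {set {set V}}).
Local Notation Vs := (distinct_tuple V s).

Definition support (x : Vs) : {set V} := [set v in tval (val x)]%SET.

Definition weight (x y : Vs) : nat :=
  if [disjoint support x & support y]
  then #|[set F in E | support x :|: support y \subset F]%SET| else 0%N.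

Definition degree (x : Vs) : nat := (\sum_(y : Vs) weight x y)%N.

Definition volume : nat := (\sum_(x : Vs) degree x)%N.

(* Every degree is at most [volume], so the initial value of the iterated
   minimum is harmless as soon as there is at least one [s]-tuple. *)
Definition min_degree : nat := (\big[Order.min/volume]_(x : Vs) degree x)%O.

(* Rows and columns are indexed through the enumeration of the [s]-tuples; the
   spectrum does not depend on it. *)
Definition adjacency (R : realType) : 'M[R]_#|{: Vs}| :=
  \matrix_(i, j) (weight (enum_val i) (enum_val j))%:R.

Definition inv_sqrt_degree (R : realType) : 'M[R]_#|{: Vs}| :=
  diag_mx (\row_i (Num.sqrt (degree (enum_val i))%:R)^-1).

Definition laplacian (R : realType) : 'M[R]_#|{: Vs}| :=
  1%:M - inv_sqrt_degree R *m adjacency R *m inv_sqrt_degree R.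

End AuxiliaryGraph.

Section Distance.
Variables (r s : nat) (E : {set {set V}}).
Local Notation Vs := (distinct_tuple V s).

(* Vertices are numbered from 0: for [i < k] the [i]-th block of a walk of
   length [k] is its [(i+1)]-st edge. *)
Definition block (v : seq V) (i : nat) : seq V := take r (drop ((r - s) * i) v).

Definition stop (v : seq V) (i : nat) : seq V := take s (drop ((r - s) * i) v).

(* A walk of length [k] has [(r - s)(k - 1) + r = (r - s) k + s] vertices, the
   second form being meaningful over [nat] also for [k = 0]. The last conjunct
   says that the stops are tuples of distinct vertices; it is automatic when
   [0 < k]. *)
Definition is_walk (k : nat) (v : seq V) : Prop :=
  [/\ size v = ((r - s) * k + s)%N,
      forall i, (i < k)%N -> uniq (block v i) /\ [set u in block v i]%SET \in E
    & forall i, (i <= k)%N -> uniq (stop v i)].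

Definition is_path (k : nat) (v : seq V) : Prop :=
  is_walk k v /\ uniq [seq stop v i | i <- iota 0 k.+1].

Definition path_between (k : nat) (x y : Vs) : Prop :=
  exists v : seq V,
    [/\ is_path k v, stop v 0 = val x :> seq V & stop v k = val y :> seq V].

(* The infimum of a nonempty set of natural numbers is its minimum; the distance
   is [+oo] when no path exists. *)
Definition distance (R : realType) (x y : Vs) : \bar R :=
  ereal_inf [set (k%:R)%:E | k in [set k : nat | path_between k x y]]%classic.

(* A supremum over a finite set, hence a maximum. *)
Definition diameter (R : realType) : \bar R :=
  ereal_sup (range (fun p : Vs * Vs => distance R p.1 p.2)).

End Distance.

End Hypergraph.

(* Main.v *)
(* The largest eigenvalue of the walk matrix M = I - 2/(lm + l1) L off the kernel
   of L has modulus at most rho = (lm - l1)/(lm + l1), where l1 > 0 forces the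
   kernel to be the line spanned by phi = (sqrt d_x)_x. Expanding in an
   orthonormal eigenbasis, the (x, y) entry of M^t is sqrt (d_x d_y) / vol up to
   an error of at most rho^t (1 - (d_x + d_y) / (2 vol)). Once rho^t <= delta/vol,
   the main term is at least delta/vol and the error strictly less, so the entry
   is nonzero; as M is supported on the diagonal and on the edges of G^(s), this
   yields a walk of length at most t in G^(s), which is shortened to a path and
   lifted to an s-path of H by listing, between consecutive stops, the remaining
   vertices of an edge containing both. *)

Require Import Defs.
From mathcomp Require Import all_boot all_order all_algebra.
From mathcomp Require Import all_classical all_reals all_analysis.
From mathcomp Require Import complex polyrcf ring lra zify.

Set Implicit Arguments.
Unset Strict Implicit.
Unset Printing Implicit Defensive.

Import Order.TTheory GRing.Theory Num.Theory.

Local Open Scope ring_scope.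

(** * The spectrum as a sorted list of roots of a characteristic polynomial *)

Lemma char_poly_similar (F : comUnitRingType) n (P A : 'M[F]_n) :
  P \in unitmx -> char_poly (invmx P *m A *m P) = char_poly A.
Proof.
move=> Punit; rewrite /char_poly.
have -> : char_poly_mx (invmx P *m A *m P) =
    map_mx polyC (invmx P) *m char_poly_mx A *m map_mx polyC P.
  rewrite /char_poly_mx !map_mxM mulmxBr mulmxBl; congr (_ - _).
  by rewrite scalar_mxC -mulmxA -map_mxM mulVmx // map_mx1 mulmx1.
rewrite !det_mulmx mulrAC mulrC -det_mulmx -map_mxM mulVmx //.
by rewrite map_mx1 det1 mulr1.
Qed.

Lemma mup_prod_XsubC (F : fieldType) (s : seq F) a :
  mup a (\prod_(x <- s) ('X - x%:P)) = count_mem a s.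
Proof.
elim: s => [|b s IH] /=; first by rewrite big_nil mupNroot // root1.
rewrite big_cons mupM ?polyXsubC_eq0 ?monic_neq0 ?monic_prod_XsubC // IH.
by rewrite -[X in mup _ X]expr1 mup_XsubCX; case: (b == a).
Qed.

Lemma sorted_flatten_nseq (R : realDomainType) (s : seq R) (m : R -> nat) :
  sorted <%R s -> sorted <=%R (flatten [seq nseq (m a) a | a <- s]).
Proof.
rewrite (sorted_pairwise lt_trans) (sorted_pairwise le_trans).
elim: s => //= a s IH /andP[as_ ss]; rewrite pairwise_cat IH // andbT.
apply/andP; split.
  apply/allrelP => x y /nseqP[-> _] /flatten_mapP[b bs /nseqP[-> _]].
  exact/ltW/(allP as_).
elim: (m a) => //= k ->; rewrite andbT.
by apply/allP => x /nseqP[-> _].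
Qed.

Lemma sorted_spectrum (R : rcfType) n (M : 'M[R]_n) :
  sorted <=%R (spectrum M).
Proof. exact/sorted_flatten_nseq/sorted_roots. Qed.

(** Both lists contain each [a] as often as its multiplicity in the characteristic polynomial: a
    value outside [rootsR] is not a root, so it does not occur in [s] either. *)
Lemma perm_spectrum (R : rcfType) n (M : 'M[R]_n) (s : seq R) :
  char_poly M = \prod_(a <- s) ('X - a%:P) -> perm_eq (spectrum M) s.
Proof.
move=> charM; apply/allP => /= a _; apply/eqP.
have charM0 : char_poly M != 0 by rewrite monic_neq0 ?char_poly_monic.
rewrite /spectrum count_flatten -map_comp.
transitivity (\sum_(b <- rootsR (char_poly M) | b == a) mup b (char_poly M))%N.
  rewrite sumnE big_map [RHS]big_mkcond; apply: eq_bigr => b _ /=.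
  by rewrite count_nseq /=; case: eqP; rewrite ?mul1n ?mul0n.
have Uroots : uniq (rootsR (char_poly M)).
  by apply: (sorted_uniq lt_trans (@ltxx _ _)); apply: sorted_roots.
have [aM|aM] := boolP (a \in rootsR (char_poly M)).
  by rewrite -big_filter filter_pred1_uniq // big_seq1 charM mup_prod_XsubC.
rewrite big1_seq => [|b /andP[/eqP-> ba]]; last by rewrite ba in aM.
apply/esym/count_memPn; apply: contra aM.
by rewrite -root_prod_XsubC -charM -roots_on_rootsR // in_itv.
Qed.

Lemma sorted_le_last (R : realDomainType) (s : seq R) a :
  sorted <=%R s -> a \in s -> a <= last 0 s.
Proof.
move=> ss as_; have s0 : (0 < size s)%N by case: s as_ {ss}.
rewrite -(nth_index 0 as_) -nth_last.
apply: (sorted_leq_nth le_trans le_refl) => //; rewrite ?inE ?index_mem //.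
  by rewrite prednK.
by rewrite -ltnS prednK // index_mem.
Qed.

(** In a sorted list only the head can precede the entry of index 1 strictly. *)
Lemma count_lt_nth1 (R : realDomainType) (s : seq R) :
  sorted <=%R s -> (count (fun a => (a < s`_1)%R) s <= 1)%N.
Proof.
case: s => [|a [|b s]] //=; first by rewrite addn0 leq_b1.
move=> /andP[_ /(order_path_min le_trans) bs].
rewrite ltxx add0n (eq_in_count (a2 := pred0)) ?count_pred0 ?addn0 ?leq_b1 //.
by move=> c cs /=; rewrite ltNge (allP bs).
Qed.

(** The enumeration [d] need not be sorted. The index [k0] takes up the only place below
    [eigval L 1], so a second index there would contradict [count_lt_nth1]. *)
Lemma spectrum_bounds (R : rcfType) n (L : 'M[R]_n) (d : 'I_n -> R) k0 k :
  perm_eq (spectrum L) [seq d k | k <- enum 'I_n] ->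
  d k0 < eigval L 1 -> k != k0 -> eigval L 1 <= d k <= eigval_max L.
Proof.
move=> Ld dk0 kk0; apply/andP; split; last first.
  apply: sorted_le_last (sorted_spectrum L) _.
  by rewrite (perm_mem Ld) map_f // mem_enum.
have := count_lt_nth1 (sorted_spectrum L); rewrite -/(eigval L 1).
rewrite (permP Ld) count_map -sum1_count big_enum_cond /= leqNgt.
rewrite leNgt; apply: contra => dk.
by rewrite (bigD1 k0) //= (bigD1 k) //= dk kk0.
Qed.

(** * Spectral decomposition of a symmetric matrix and the decay of its powers *)

Section SymmetricSpectrum.
Local Open Scope sesquilinear_scope.

(** Over [R[i]] the matrix is Hermitian, so it is unitarily diagonalizable with real eigenvalues
    [d]. The characteristic polynomials are compared over [R[i]] and the equality descends to [R] by
    injectivity of the embedding. *)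
Lemma symmetric_spectral (R : rcfType) n (M : 'M[R]_n) : M^T = M ->
  exists (d : 'I_n -> R) (P : 'M[R[i]]_n),
    [/\ P *m P ^t* = 1%:M, P ^t* *m P = 1%:M,
        map_mx (real_complex R) M =
          P ^t* *m diag_mx (\row_k real_complex R (d k)) *m P
      & perm_eq (spectrum M) [seq d k | k <- enum 'I_n]].
Proof.
move=> Msym; pose A := map_mx (real_complex R) M.
have Aherm : A \is hermsymmx.
  apply: realsym_hermsym.
    by apply/is_hermitianmxP; rewrite expr0 scale1r map_mx_id // map_trmx Msym.
  by apply/mxOverP => i j; rewrite mxE; apply/complex_realP; exists (M i j).
have Adiag := orthomx_spectralP (hermitian_normalmx Aherm).
have /mxOverP Dreal := hermitian_spectral_diag_real Aherm.
have PU := spectral_unitarymx A; have Pu := unitarymx_unit PU.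
pose d k := complex.Re (spectral_diag A 0 k).
have dE : spectral_diag A = \row_k real_complex R (d k).
  by apply/rowP => k; rewrite mxE RRe_real.
exists d, (spectralmx A); split.
- exact/unitarymxP.
- by rewrite -invmx_unitary // mulVmx.
- by rewrite -/A {1}Adiag dE invmx_unitary.
apply: perm_spectrum; apply: (map_poly_inj (real_complex R)).
rewrite map_char_poly -/A Adiag char_poly_similar // dE.
rewrite char_poly_trig ?diag_mx_is_trig // rmorph_prod big_map big_enum /=.
by apply: eq_bigr => k _; rewrite !mxE eqxx mulr1n rmorphB /= map_polyX map_polyC.
Qed.

Lemma mulmx_diag_entry (C : numClosedFieldType) n (P : 'M[C]_n) (v : 'rV_n) i j :
  (P ^t* *m diag_mx v *m P) i j = \sum_k (P k i)^* * v 0 k * P k j.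
Proof.
rewrite mxE; apply: eq_bigr => k _; congr (_ * _).
by rewrite mul_mx_diag !mxE.
Qed.

Lemma exp_unitary_diag (C : numClosedFieldType) n (P : 'M[C]_n) (v : 'rV_n) t :
  P *m P ^t* = 1%:M -> P ^t* *m P = 1%:M ->
  (P ^t* *m diag_mx v *m P) ^+ t = P ^t* *m diag_mx (\row_k v 0 k ^+ t) *m P.
Proof.
move=> PPt PtP; elim: t => [|t IH].
  rewrite expr0 (_ : \row_k _ = const_mx 1) ?diag_const_mx ?mulmx1 ?PtP //.
  by apply/rowP => k; rewrite !mxE expr0.
rewrite exprS IH -[_ * _]/(_ *m _) !mulmxA -(mulmxA _ P) PPt mulmx1.
rewrite -[_ *m diag_mx v *m _]mulmxA mulmx_diag; congr (_ *m diag_mx _ *m _).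
by apply/rowP => k; rewrite !mxE exprS.
Qed.

Local Notation toC := (real_complex _).

(* With [c = P phi] the equations [d_k c_k = 0] leave a single nonzero coordinate
   [c_k0], whence [conj (P k0 i) * P k0 j = phi_i phi_j / N]. *)
Lemma spectral_power_gap (R : rcfType) n (L : 'M[R]_n) (phi : 'cV[R]_n) t i j
    (l1 := eigval L 1) (lm := eigval_max L) (N := \sum_k phi k 0 ^+ 2) :
  L^T = L -> L *m phi = 0 -> phi != 0 -> 0 < l1 -> l1 <= lm ->
  `|((1%:M - (2 / (lm + l1)) *: L) ^+ t) i j - phi i 0 * phi j 0 / N|
    <= ((lm - l1) / (lm + l1)) ^+ t *
       (1 - (phi i 0 ^+ 2 + phi j 0 ^+ 2) / (2 * N)).
Proof.
move=> Lsym Lphi phi0 l1_gt0 l1_le_lm.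
have [d [P [PPt PtP LP Ld]]] := symmetric_spectral Lsym.
pose fphi := map_mx toC phi; pose c := P *m fphi.
have fphiE : fphi = P ^t* *m c by rewrite mulmxA PtP mul1mx.
clearbody c.
have dc k : toC (d k) * c k 0 = 0.
  have : diag_mx (\row_k toC (d k)) *m c = 0.
    have : map_mx toC L *m fphi = 0 by rewrite -map_mxM Lphi map_mx0.
    rewrite LP fphiE => /(congr1 (mulmx P)).
    by rewrite mulmx0 !mulmxA PPt mul1mx -(mulmxA _ P) PPt mulmx1.
  by move=> /matrixP/(_ k 0); rewrite mul_diag_mx !mxE.
have [k0 ck0] : exists k0, c k0 0 != 0.
  apply/existsP; apply: contraNT phi0; rewrite negb_exists => /forallP c0.
  apply/eqP; apply: (map_mx_inj (f := toC)); rewrite map_mx0 -/fphi fphiE.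
  rewrite (_ : c = 0) ?mulmx0 //; apply/colP => k; rewrite [RHS]mxE.
  exact/eqP/negPn/c0.
have d0 : d k0 = 0.
  apply: (complexI (R := R)); apply/eqP; move/eqP: (dc k0).
  by rewrite mulf_eq0 (negbTE ck0) orbF.
have dP k : k != k0 -> l1 <= d k <= lm.
  by apply: (spectrum_bounds Ld); rewrite d0.
have ck k : k != k0 -> c k 0 = 0.
  move=> /dP/andP[l1d _]; apply/eqP; move/eqP: (dc k); rewrite mulf_eq0.
  rewrite (fmorph_eq0 (real_complex R)) gt_eqF //; exact: lt_le_trans l1d.
have phiE a : toC (phi a 0) = (P k0 a)^* * c k0 0.
  have -> : toC (phi a 0) = fphi a 0 by rewrite mxE.
  rewrite fphiE mxE (bigD1 k0) //= big1 ?addr0 => [|k /ck->]; last by rewrite mulr0.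
  by rewrite !mxE.
(* [phi] is real, so [phiE] may be conjugated; in the product of the two formulas [c k0 0] enters
   only through its squared modulus, which is [N]. *)
have phiJ a : toC (phi a 0) = P k0 a * (c k0 0)^*.
  have /CrealP <- : toC (phi a 0) \is Num.real.
    by apply/complex_realP; exists (phi a 0).
  by rewrite phiE rmorphM /= conjCK.
have rowP k : \sum_a `|P k a| ^+ 2 = 1.
  have /matrixP/(_ k k) := PPt; rewrite !mxE eqxx mulr1n => <-.
  by apply: eq_bigr => a _; rewrite !mxE normCK.
have colP a : \sum_k `|P k a| ^+ 2 = 1.
  have /matrixP/(_ a a) := PtP; rewrite !mxE eqxx mulr1n => <-.
  by apply: eq_bigr => k _; rewrite !mxE normCKC.
have NE : toC N = `|c k0 0| ^+ 2.
  rewrite -[RHS]mul1r -(rowP k0) mulr_suml /N rmorph_sum; apply: eq_bigr => a _.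
  by rewrite rmorphXn /= expr2 {1}phiE phiJ !normCK mulrACA [X in X * _]mulrC.
have N0 : toC N != 0 by rewrite NE expf_neq0 ?normr_eq0.
have P0E a b : (P k0 a)^* * P k0 b = toC (phi a 0 * phi b 0 / N).
  apply: (mulIf N0); rewrite -rmorphM mulfVK; last first.
    by apply: contra N0 => /eqP->; rewrite rmorph0.
  by rewrite rmorphM /= phiE phiJ NE normCK mulrACA.
pose mu k := 1 - 2 / (lm + l1) * d k.
have BE : map_mx toC (1%:M - (2 / (lm + l1)) *: L) =
          P ^t* *m diag_mx (\row_k toC (mu k)) *m P.
  have -> : diag_mx (\row_k toC (mu k)) =
            1%:M - toC (2 / (lm + l1)) *: diag_mx (\row_k toC (d k)).
    apply/matrixP => a b; rewrite !mxE rmorphB rmorph1 rmorphM /=.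
    by case: eqP => _; rewrite ?mulr0n ?mulr0 ?subr0 ?mulr1n.
  by rewrite mulmxBr mulmxBl mulmx1 PtP -scalemxAr -scalemxAl map_mxB map_mx1
    map_mxZ LP.
have BtE : toC (((1%:M - (2 / (lm + l1)) *: L) ^+ t) i j) =
    \sum_k (P k i)^* * toC (mu k) ^+ t * P k j.
  transitivity ((map_mx toC (1%:M - (2 / (lm + l1)) *: L) ^+ t) i j).
    by rewrite -rmorphXn mxE.
  rewrite BE exp_unitary_diag // mulmx_diag_entry.
  by apply: eq_bigr => k _; rewrite !mxE.
have mu0 : mu k0 = 1 by rewrite /mu d0 mulr0 subr0.
have normR (x : R) : toC `|x| = `|toC x|.
  by rewrite normc_def /= expr0n addr0 sqrtr_sqr.
(* Column [a] of [P] has norm 1, and its entry in row [k0] has squared modulus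
   [phi a 0 ^+ 2 / N]. *)
have sum_neq0 a : \sum_(k | k != k0) `|P k a| ^+ 2 = toC (1 - phi a 0 ^+ 2 / N).
  apply: (addrI (`|P k0 a| ^+ 2)).
  have := colP a; rewrite (bigD1 k0) //= => ->; rewrite normCKC P0E.
  by rewrite -expr2 -rmorphD addrC subrK rmorph1.
(* The term at [k0], with eigenvalue 1, cancels the main term exactly. *)
rewrite -lecR normR rmorphB /= BtE (bigD1 k0) //= mu0 rmorph1 expr1n mulr1 P0E.
rewrite addrAC subrr add0r.
have lm_gt0 : 0 < lm + l1 by rewrite addr_gt0 // (lt_le_trans l1_gt0).
(* The factor [2 / (lm + l1)] is chosen so that the affine map sends [l1] and [lm] to opposite
   values, namely plus and minus [(lm - l1) / (lm + l1)]. *)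
have mu_le k : k != k0 -> `|mu k| <= (lm - l1) / (lm + l1).
  move=> /dP/andP[l1d dlm]; rewrite ler_pdivlMr // -[X in _ * X]gtr0_norm // -normrM.
  rewrite /mu mulrBl mul1r mulrAC divfK ?gt_eqF // ler_norml.
  by apply/andP; split; lra.
set rho := (lm - l1) / (lm + l1).
(* The inequality of arithmetic and geometric means separates [i] from [j], so that [sum_neq0]
   evaluates each half. *)
apply: (@le_trans _ _ (\sum_(k | k != k0)
    toC (rho ^+ t) * ((`|P k i| ^+ 2 + `|P k j| ^+ 2) / 2))).
  apply: le_trans (ler_norm_sum _ _ _) _; apply: ler_sum => k kk0.
  rewrite !normrM norm_conjC normrX -normR -rmorphXn mulrAC mulrC.
  apply: ler_pM; rewrite ?mulr_ge0 ?normr_ge0 ?ler0c ?exprn_ge0 //.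
    by rewrite lecR lerXn2r ?nnegrE ?normr_ge0 ?mu_le // (le_trans _ (mu_le _ kk0)).
  exact/real_leif_mean_square/normr_real/normr_real.
rewrite -mulr_sumr -mulr_suml big_split /= !sum_neq0 -rmorphD.
rewrite -[2](rmorph_nat (real_complex R)) -fmorphV -!rmorphM lecR le_eqVlt; apply/orP; left; apply/eqP.
congr (_ * _).
by field; apply: contraNneq N0 => ->; rewrite rmorph0.
Qed.

End SymmetricSpectrum.

(** * Nonzero entries of matrix powers and paths in the underlying graph *)

Lemma expmx_neq0_path (K : pzSemiRingType) (T : eqType) n (B : 'M[K]_n)
    (f : 'I_n -> T) (e : rel T) :
  (forall i j, B i j != 0 -> i = j \/ e (f i) (f j)) ->
  forall t i j, (B ^+ t) i j != 0 ->
  exists p, [/\ path e (f i) p, last (f i) p = f j & (size p <= t)%N].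
Proof.
move=> Be; elim=> [|t IH] i j.
  rewrite expr0 mxE; have [-> _|_] := eqVneq i j; first by exists [::].
  by rewrite eqxx.
rewrite exprS mxE => /eqP Bt.
have [k Bk] : exists k, B i k * (B ^+ t) k j != 0.
  apply/existsP; apply: contra_notT Bt; rewrite negb_exists => /forallP B0.
  by apply: big1 => k _; apply/eqP/negPn/B0.
have /IH[p [ep lp sp]] : (B ^+ t) k j != 0.
  by apply: contraNneq Bk => ->; rewrite mulr0.
(* A diagonal factor stays in place and adds no vertex, hence only an upper bound on the length. *)
have /Be[->|eik] : B i k != 0 by apply: contraNneq Bk => ->; rewrite mul0r.
  by exists p; split => //; apply: leqW.
by exists (f k :: p); split => //=; rewrite eik.
Qed.

Lemma ffact_addn n m k : n ^_ (m + k) = (n ^_ m * (n - m) ^_ k)%N.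
Proof.
elim: m n => [|m IH] n; first by rewrite ffactn0 mul1n subn0.
by rewrite addSn !ffactnS IH mulnA subnS predn_sub.
Qed.

(** * Counting in the auxiliary graph and lifting its paths to the hypergraph *)

Section Combinatorics.
Variables (V : finType) (r s : nat) (E : {set {set V}}).
Local Notation Vs := (distinct_tuple V s).

Lemma card_support (x : Vs) : #|Defs.support x| = s.
Proof.
by rewrite /Defs.support cardsE (card_uniqP (valP x)) size_tuple.
Qed.

Lemma card_support_subset (A : {set V}) :
  #|[set x : Vs | Defs.support x \subset A]%SET| = #|A| ^_ s.
Proof.
rewrite -card_uniq_tuples -(card_imset _ val_inj).
apply: eq_card => t; rewrite !inE; apply/imsetP/andP.
  move=> [x]; rewrite inE => /fintype.subsetP xA ->; split; last exact: (valP x).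
  by apply/allP => v vx; apply: xA; rewrite inE.
move=> [/allP tA tu]; exists (exist _ t tu) => //.
by rewrite inE; apply/fintype.subsetP => v; rewrite inE => /tA.
Qed.

(** Disjointness is absorbed into the inclusion in [F :\: support x], which makes the weight a sum
    of indicators over edges, ready for exchanging sums. *)
Lemma weight_sum (x y : Vs) : weight E x y =
  (\sum_(F in E) ((Defs.support x \subset F) && (Defs.support y \subset F :\: Defs.support x)))%N.
Proof.
rewrite /weight; case: ifPn => [xy|nxy].
  rewrite -sum1_card big_mkcond [RHS]big_mkcond; apply: eq_bigr => F _.
  rewrite !inE; case: (F \in E) => //=.
  rewrite finset.subUset finset.subsetD [X in _ && (_ && X)]disjoint_sym xy andbT.
  by case: (_ && _).
rewrite big1 // => F _; rewrite finset.subsetD [X in _ && (_ && X)]disjoint_sym.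
by rewrite (negbTE nxy) !andbF.
Qed.

Lemma weight_sym (x y : Vs) : weight E x y = weight E y x.
Proof. by rewrite /weight disjoint_sym finset.setUC. Qed.

Lemma weight_gt0P (x y : Vs) : reflect
  (exists2 F, F \in E & (Defs.support x \subset F) && (Defs.support y \subset F :\: Defs.support x))
  (0 < weight E x y)%N.
Proof.
rewrite weight_sum; apply: (iffP idP) => [|[F FE xyF]].
  rewrite lt0n sum_nat_eq0 negb_forall => /existsP[F].
  by rewrite negb_imply eqb0 negbK => /andP[FE xyF]; exists F.
by rewrite (bigD1 F) //= xyF.
Qed.

Hypothesis hE : uniform r E.
Hypothesis hs : (2 * s <= r)%N.

(** Double counting: each edge contains [r ^_ s] tuples [x], and each of them leaves [(r - s) ^_ s]
    tuples [y] in the rest of the edge. *)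
Lemma volume_uniform : volume s E = (#|E| * r ^_ (2 * s))%N.
Proof.
rewrite /volume /degree.
under eq_bigr => x _ do under eq_bigr => y _ do rewrite weight_sum.
under eq_bigr => x _ do rewrite exchange_big /=.
rewrite exchange_big /= -sum_nat_const; apply: eq_bigr => F FE.
transitivity (\sum_(x : Vs | Defs.support x \subset F) (r - s) ^_ s)%N.
  rewrite [RHS]big_mkcond; apply: eq_bigr => x _.
  case: ifP => xF; last by rewrite big1.
  have -> : (r - s)%N = #|F :\: Defs.support x|.
    by rewrite cardsDS // card_support (hE FE).
  rewrite -card_support_subset.
  rewrite -sum1_card big_mkcond [in RHS]big_mkcond /=; apply: eq_bigr => y _.
  by rewrite inE; case: (_ \subset _).
rewrite sum_nat_const mul2n -addnn ffact_addn; congr (_ * _)%N.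
by rewrite -(hE FE) -card_support_subset cardsE.
Qed.

Lemma degree_gt0 (x : Vs) :
  (forall S : {set V}, #|S| = s -> exists2 F, F \in E & S \subset F) ->
  (0 < degree E x)%N.
Proof.
move=> /(_ _ (card_support x))[F FE xF].
have : (0 < #|[set y : Vs | Defs.support y \subset F :\: Defs.support x]%SET|)%N.
  rewrite card_support_subset cardsDS // card_support (hE FE) ffact_gt0; lia.
case/card_gt0P => y; rewrite inE => yF.
rewrite /degree (bigD1 y) //= addn_gt0.
by apply/orP; left; apply/weight_gt0P; exists F; rewrite ?xF.
Qed.

Lemma walk_of_graph_path (x : Vs) (p : seq Vs) :
  path (fun y z => 0 < weight E y z)%N x p ->
  exists2 v, is_walk r s E (size p) v &
    forall i, (i <= size p)%N -> stop r s v i = val (nth x (x :: p) i).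
Proof.
elim: p x => [|y p IH] x /=.
  move=> _; have st : stop r s (val x) 0 = val x.
    by rewrite /stop muln0 drop0 take_oversize // size_tuple.
  exists (val x).
    split=> // [|i]; first by rewrite muln0 size_tuple.
    by rewrite leqn0 => /eqP->; rewrite st; apply: (valP x).
  by move=> i; rewrite leqn0 => /eqP->.
move=> /andP[/weight_gt0P[F FE /andP[xF yF]] /IH[v [sv bv uv] stv]].
(* [z] lists the [r - 2 * s] other vertices of [F]. Then [val x ++ z] has length [r - s], the shift
   between consecutive blocks, so prepending it to [v] moves every block and stop up by one
   index. *)
pose z := enum (F :\: (Defs.support x :|: Defs.support y)).
have xyF : Defs.support x :|: Defs.support y \subset F.
  by rewrite finset.subUset xF; move: yF; rewrite finset.subsetD => /andP[].
have xy0 : [disjoint Defs.support x & Defs.support y].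
  by move: yF; rewrite finset.subsetD disjoint_sym => /andP[].
have sz : size (val x ++ z) = (r - s)%N.
  rewrite size_cat size_tuple -cardE cardsDS // (hE FE) cardsU !card_support.
  by rewrite (finset.disjoint_setI0 xy0) cards0; lia.
pose v' := val x ++ z ++ v.
have dropv i : drop ((r - s) * i.+1) v' = drop ((r - s) * i) v.
  by rewrite mulnS addnC -drop_drop /v' catA -sz drop_size_cat.
have st0 : stop r s v' 0 = val x.
  by rewrite /stop muln0 drop0 /v' take_size_cat // size_tuple.
have stS i : stop r s v' i.+1 = stop r s v i by rewrite /stop dropv.
(* The new first block runs past [z] into the first [s] vertices of [v], which are its stop 0, that
   is [y]. *)
have bl0 : block r s v' 0 = val x ++ z ++ val y.
  have /= vy := stv 0%N isT; rewrite /block muln0 drop0 /v' !catA.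
  rewrite take_cat sz ltnNge leq_subr /= -vy /stop muln0 drop0.
  by congr (_ ++ take _ _); lia.
exists v'; last by case=> [|i] // ip; rewrite stS stv //= (set_nth_default x).
split=> [|[_|i ip]|[_|i ip]].
- by rewrite /v' catA size_cat sz sv mulnS addnA.
- rewrite bl0; split.
    rewrite !cat_uniq (valP x) (valP y) enum_uniq /= andbT.
    apply/andP; split; apply/hasPn => v0.
      rewrite mem_cat mem_enum !inE negb_or => /orP[/andP[/andP[]] //|v0y].
      apply: contraL v0y => v0x; move/pred0P: xy0 => /(_ v0) /=.
      by rewrite !inE v0x => /= ->.
    by apply: contraL; rewrite mem_enum !inE negb_or -andbA => /and3P[_ ->].
  rewrite (_ : [set u in _]%SET = F) //; apply/setP => u.
  rewrite !inE !mem_cat mem_enum !inE.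
  have := fintype.subsetP xyF u; rewrite !inE.
  case: (u \in tval (val x)); case: (u \in tval (val y));
    by case: (u \in F) => //= ->.
- by rewrite /block dropv; apply: bv.
- by rewrite st0; apply: (valP x).
- by rewrite stS; apply: uv.
Qed.

Lemma path_between_of_graph_path (x : Vs) (p : seq Vs) :
  path (fun y z => 0 < weight E y z)%N x p -> uniq (x :: p) ->
  path_between r E (size p) x (last x p).
Proof.
move=> /walk_of_graph_path[v wv stv] up; exists v; split.
(* The stops are the vertices of the graph path, so their distinctness is [up]. *)
- split=> //; rewrite (_ : [seq _ | i <- _] = [seq val (val y) | y <- x :: p]).
    by rewrite map_inj_uniq // => y z /val_inj/val_inj.
  apply: (@eq_from_nth _ [::]); rewrite !size_map size_iota // => i ip.
  rewrite (nth_map 0%N) ?size_iota // nth_iota // add0n stv //.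
  by rewrite (nth_map x).
- by rewrite stv.
- by rewrite stv // -last_nth.
Qed.

End Combinatorics.

Lemma sum_enum_val (T : finType) (F : T -> nat) :
  (\sum_(i < #|{: T}|) F (enum_val i) = \sum_(x : T) F x)%N.
Proof.
by rewrite [RHS](reindex (@enum_val T {: T})) //; apply/onW_bij/enum_val_bij.
Qed.

(** * The kernel vector of the Laplacian and the nonvanishing of entries of powers *)

Section Laplacian.
Variables (R : realType) (V : finType) (s : nat) (E : {set {set V}}).
Local Notation Vs := (distinct_tuple V s).
Local Notation L := (laplacian s E R).
Local Notation deg i := ((degree E (enum_val i : Vs))%:R : R).

Lemma laplacianE i j : L i j = (i == j)%:R -
  (Num.sqrt (deg i))^-1 * (weight E (enum_val i : Vs) (enum_val j))%:R
    * (Num.sqrt (deg j))^-1.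
Proof. by rewrite /laplacian /inv_sqrt_degree mul_mx_diag mul_diag_mx !mxE. Qed.

(** The volume is the initial value of the iterated minimum, so its positivity is needed along with
    that of the degrees. *)
Lemma min_degree_gt0 :
  (forall x : Vs, 0 < degree E x)%N -> (0 < volume s E)%N ->
  (0 < min_degree s E)%N.
Proof.
move=> deg_gt0 vol_gt0; rewrite /min_degree; elim/big_ind: _ => // m k m0 k0.
by rewrite /Order.min; case: ifP.
Qed.

Lemma laplacian_sym : L^T = L.
Proof.
apply/matrixP => i j; rewrite mxE !laplacianE eq_sym weight_sym.
by congr (_ - _); rewrite mulrAC [in RHS]mulrC mulrA.
Qed.

(** With [T] the diagonal degree matrix and [A] the adjacency matrix, the product is the vector of
    row sums of [T - A] scaled by inverse square roots, and the row sums of [A] are the degrees. *)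
Lemma laplacian_sqrt_degree :
  (forall x : Vs, 0 < degree E x)%N -> L *m (\col_i Num.sqrt (deg i)) = 0.
Proof.
move=> deg_gt0; apply/colP => i; rewrite !mxE.
have sq_neq0 (k : 'I_#|{: Vs}|) : Num.sqrt (deg k) != 0 by rewrite sqrtr_eq0 -ltNge ltr0n.
under eq_bigr => j _ do rewrite laplacianE eq_sym mxE mulrBl divfK // mulr_natl mulrb.
rewrite sumrB -big_mkcond big_pred1_eq -mulr_sumr -natr_sum.
rewrite (sum_enum_val (weight E (enum_val i))) -/(degree E (enum_val i)) -{3}[deg i]sqr_sqrtr // expr2.
by rewrite mulKf // subrr.
Qed.

Lemma laplacian_power_neq0 t (i j : 'I_#|{: Vs}|)
    (l1 := eigval L 1) (lm := eigval_max L) :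
  (forall x : Vs, 0 < degree E x)%N -> 0 < l1 -> l1 < lm ->
  ((lm - l1) / (lm + l1)) ^+ t <= (min_degree s E)%:R / (volume s E)%:R ->
  ((1%:M - (2 / (lm + l1)) *: L) ^+ t) i j != 0.
Proof.
move=> deg_gt0 l1_gt0 l1_lm rho_le.
set phi : 'cV[R]_#|{: Vs}| := \col_i Num.sqrt (deg i).
have phiX k : phi k 0 ^+ 2 = deg k by rewrite mxE sqr_sqrtr.
have phi_neq0 : phi != 0.
  apply/eqP => /matrixP/(_ i 0)/(congr1 (fun a => a ^+ 2)).
  by rewrite phiX mxE expr0n /= => /eqP; rewrite pnatr_eq0 gtn_eqF.
have sum_phi : \sum_k phi k 0 ^+ 2 = (volume s E)%:R.
  rewrite (eq_bigr _ (fun k _ => phiX k)) -natr_sum /volume.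
  by rewrite (sum_enum_val (degree E)).
set d : R := (min_degree s E)%:R; set N : R := (volume s E)%:R.
have d_le k : d <= deg k by rewrite ler_nat -leEnat /min_degree bigmin_le.
have N_gt0 : 0 < N.
  by rewrite ltr0n /volume (bigD1 (enum_val i)) //= addn_gt0 deg_gt0.
have d_gt0 : 0 < d.
  by rewrite ltr0n min_degree_gt0 // -(ltr0n R).
have := spectral_power_gap t i j laplacian_sym (laplacian_sqrt_degree deg_gt0)
  phi_neq0 l1_gt0 (ltW l1_lm).
rewrite -/l1 -/lm sum_phi -/N !phiX => gap; apply/negP => /eqP M0.
have rho_gt0 : 0 < ((lm - l1) / (lm + l1)) ^+ t.
  by rewrite exprn_gt0 // divr_gt0 ?subr_gt0 ?addr_gt0 // (lt_trans l1_gt0).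
move: gap; rewrite M0 sub0r normrN ger0_norm; last first.
  by rewrite !mxE !mulr_ge0 ?sqrtr_ge0 // invr_ge0 ltW.
apply/negP; rewrite -ltNge.
(* Positive degrees make the factor [1 - (d_i + d_j) / (2 N)] smaller than 1; this is where
   strictness comes from. *)
apply: (@lt_le_trans _ _ (((lm - l1) / (lm + l1)) ^+ t)).
  rewrite gtr_pMr // ltrBlDr ltrDl divr_gt0 ?mulr_gt0 //.
  by rewrite addr_gt0 // (lt_le_trans d_gt0).
apply: le_trans rho_le _; rewrite ler_pdivrMr // divfK ?gt_eqF //.
(* [d] is the square root of [d ^+ 2], which is at most the product of the two degrees. *)
rewrite !mxE -sqrtrM // -[leLHS]ger0_norm ?(ltW d_gt0) // -sqrtr_sqr ler_wsqrtr //.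
by rewrite expr2 ler_pM // ltW.
Qed.

End Laplacian.

(** Used with [a] the volume over the minimum degree and [q] the inverse of the decay rate: it turns
    the logarithmic bound on [t] into the hypothesis of [laplacian_power_neq0]. *)
Lemma exp_inv_le_of_ln (R : realType) (q a : R) (t : nat) :
  1 < q -> 0 < a -> ln a / ln q <= t%:R -> q^-1 ^+ t <= a^-1.
Proof.
move=> q1 a0; have q0 : 0 < q by apply: lt_trans q1.
rewrite ler_pdivrMr ?ln_gt0 // => h.
rewrite exprVn lef_pV2 ?posrE ?exprn_gt0 //.
by rewrite -ler_ln ?posrE ?exprn_gt0 // lnXn // -mulr_natl.
Qed.

(** * From nonzero matrix entries to the diameter *)

Theorem theorem12 (R : realType) (V : finType) (r s : nat)
    (E : {set {set V}})
    (hr : (2 <= r)%N) (hs1 : (1 <= s)%N) (hs2 : (2 * s <= r)%N)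
    (hn : (r <= #|V|)%N) (hE : uniform r E)
    (hcov : forall S : {set V}, #|S| = s -> exists2 F, F \in E & S \subset F) :
  let lambda1 : R := eigval (laplacian s E R) 1 in
  let lambdamax : R := eigval_max (laplacian s E R) in
  volume s E = (#|E| * (r`! %/ (r - 2 * s)`!))%N /\
  (0 < lambda1 -> lambda1 < lambdamax ->
   (diameter r s E R <=
    ((Num.ceil
        (ln ((volume s E)%:R / (min_degree s E)%:R : R) /
         ln ((lambdamax + lambda1) / (lambdamax - lambda1))))%:~R)%:E)%E).
Proof.
move=> l1 lm; split; first by rewrite (volume_uniform s hE) ffact_factd.
move=> l1_gt0 l1_lm.
have deg_gt0 (x : distinct_tuple V s) : (0 < degree E x)%N.
  exact: (degree_gt0 hE hs2 x hcov).
set a : R := _%:R / _; set q := (lm + l1) / (lm - l1).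
have q_gt1 : 1 < q.
  by rewrite /q ltr_pdivlMr ?subr_gt0 // mul1r ltrD2l gtrN.
apply: ge_ereal_sup => _ [[x y] _ <-] /=.
have vol_gt0 : (0 < volume s E)%N.
  by rewrite /volume (bigD1 x) //= addn_gt0 deg_gt0.
have min_gt0 : (0 < min_degree s E)%N by apply: min_degree_gt0.
have a_ge1 : 1 <= a.
  by rewrite ler_pdivlMr ?ltr0n // mul1r ler_nat -leEnat bigmin_le_id.
set c := Num.ceil _.
(* A ceiling is nonnegative as soon as its argument exceeds -1; here [a_ge1] and [q_gt1] make the
   quotient of logarithms nonnegative, so [c] can serve as a natural exponent [t]. *)
have c_ge0 : 0 <= c.
  by rewrite ceil_ge0 (@lt_le_trans _ _ 0) ?ltrN10 // divr_ge0 ?ln_ge0 // ltW.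
have [t ct] : exists t : nat, c = t :> int by exists `|c|%N; rewrite gez0_abs.
have qE : (lm - l1) / (lm + l1) = q^-1 by rewrite invf_div.
pose adj := fun y z : distinct_tuple V s => (0 < weight E y z)%N.
have : 
    ((1%:M - (2 / (lm + l1)) *: laplacian s E R) ^+ t)
      (enum_rank x) (enum_rank y) != 0.
  apply: laplacian_power_neq0 => //; rewrite qE -invf_div.
  apply: exp_inv_le_of_ln => //; first exact: lt_le_trans a_ge1.
  by rewrite -/a -[t%:R]/((t : int)%:~R) -ct ceil_ge.
have entry_adj i j : (1%:M - (2 / (lm + l1)) *: laplacian s E R) i j != 0 ->
    i = j \/ adj (enum_val i) (enum_val j).
  have [->|ij] := eqVneq i j; first by left.
  have -> : (1%:M - (2 / (lm + l1)) *: laplacian s E R) i j =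
      (i == j)%:R - 2 / (lm + l1) * laplacian s E R i j.
    (* Generalizing the Laplacian keeps [mxE] from unfolding its entries. *)
    by move: (laplacian s E R) => M; rewrite !mxE.
  rewrite laplacianE (negbTE ij) => M0; right; rewrite /adj lt0n.
  by apply: contraNneq M0 => ->; rewrite mulr0 mul0r subr0 mulr0 subr0.
case/(expmx_neq0_path entry_adj) => p0 [].
(* Removing repetitions makes the stops distinct, as a path requires, and does not increase the
   length. *)
rewrite !enum_rankK => /shortenP[p adj_p p_uniq p_sub] py p0t.
have pt : (size p <= t)%N.
  apply: leq_trans p0t; apply: uniq_leq_size p_sub.
  by case/andP: p_uniq.
apply: (@le_trans _ _ ((size p)%:R%:E)%E).
  apply: ereal_inf_lbound; exists (size p) => //=.
  by rewrite -py; apply: path_between_of_graph_path.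
by rewrite lee_fin ct ler_nat.
Qed.
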